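(* Let $M_{3,k}$ ($k=0,1,2,3$) be the graph with vertex set $\{a_1,a_2,a_3\}\cup\{x_i : 1\le i\le k\}$ whose edges are $a_1a_2$, $a_1a_3$, $a_2a_3$ and $a_ix_i$ for $1\le i\le k$. (1) Each of the four graphs $M_{3,0},M_{3,1},M_{3,2},M_{3,3}$ is the zero-divisor graph of a commutative zero-divisor semigroup; that is, for each of these graphs $G$ there is a commutative zero-divisor semigroup $S$ with $\Gamma(S)\cong G$. (2) Up to isomorphism there are exactly three commutative zero-divisor semigroups $S$ with $\Gamma(S)\cong M_{3,2}$. They are the three pairwise non-isomorphic semigroups on the set $\{0,a_1,a_2,a_3,x_1,x_2\}$, with zero element $0$, whose commutative multiplication is given by $$a_1a_2=a_1a_3=a_2a_3=0,\quad a_1x_1=0,\quad a_1x_2=a_1,\quad a_2x_1=a_2,\quad a_2x_2=0,$$ $$a_3^2=a_3,\quad a_3x_1=a_3,\quad a_3x_2=a_3,\quad x_1^2=x_1,\quad x_1x_2=a_3,\quad x_2^2=x_2,$$ together with one of the following three choices of $(a_1^2,a_2^2)$: $$(a_1^2,a_2^2)=(0,0),\qquad (a_1^2,a_2^2)=(0,a_2),\qquad (a_1^2,a_2^2)=(a_1,a_2).$$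
   Context: All semigroups are commutative, written multiplicatively, and have a zero element $0$ (so $0x=0$ for all $x$). An element $x$ of a semigroup $S$ is a zero-divisor if $xy=0$ for some $y\in S$ with $y\ne 0$. A zero-divisor semigroup is a commutative semigroup with $0$ all of whose elements are zero-divisors. The zero-divisor graph $\Gamma(S)$ is the undirected simple graph whose vertices are the nonzero zero-divisors of $S$, two distinct vertices $x,y$ being adjacent if and only if $xy=0$. The four graphs $M_{3,k}$, $0\le k\le 3$, are (up to isomorphism) the subgraphs containing $K_3$ of the graph $\Gamma_3=M_{3,3}$, the complete graph $K_3$ together with three end vertices attached to distinct vertices of $K_3$. *)

(* Defs.v *)
From mathcomp Require Import all_boot.

Set Implicit Arguments.
Unset Strict Implicit.
Unset Printing Implicit Defensive.

(* The carrier is an arbitrary Type: MathComp's semigroupType would impose a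
   choice structure, and has no commutative variant with a zero. *)
Record czsemigroup (T : Type) := CZSemigroup {
  zero : T;
  mul : T -> T -> T;
  mul_assoc : associative mul;
  mul_comm : commutative mul;
  mul_zero : left_zero zero mul
}.

Definition semigroup_iso (T U : Type)
    (S : czsemigroup T) (S' : czsemigroup U) : Prop :=
  exists2 f : T -> U, bijective f & {morph f : x y / mul S x y >-> mul S' x y}.

Definition zero_divisor (T : Type) (S : czsemigroup T) (x : T) : Prop :=
  exists2 y, y <> zero S & mul S x y = zero S.

Definition zd_semigroup (T : Type) (S : czsemigroup T) : Prop :=
  forall x, zero_divisor S x.

Record sgraph (V : Type) := SGraph {
  adj : V -> V -> Prop;
  adj_sym : forall u v, adj u v -> adj v u;
  adj_irrefl : forall u, ~ adj u u
}.

Definition graph_iso (V W : Type) (G : sgraph V) (H : sgraph W) : Prop :=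
  exists2 f : V -> W, bijective f & forall u v, adj G u v <-> adj H (f u) (f v).

Definition zd_vertex (T : Type) (S : czsemigroup T) : Type :=
  {x : T | x <> zero S /\ zero_divisor S x}.

Definition zd_adj (T : Type) (S : czsemigroup T) (u v : zd_vertex S) : Prop :=
  sval u <> sval v /\ mul S (sval u) (sval v) = zero S.

Lemma zd_adj_sym (T : Type) (S : czsemigroup T) (u v : zd_vertex S) :
  zd_adj u v -> zd_adj v u.
Proof. by case=> neq uv0; split; [move=> /esym | rewrite mul_comm]. Qed.

Lemma zd_adj_irrefl (T : Type) (S : czsemigroup T) (u : zd_vertex S) :
  ~ zd_adj u u.
Proof. by case. Qed.

Definition zd_graph (T : Type) (S : czsemigroup T) : sgraph (zd_vertex S) :=
  SGraph (@zd_adj_sym T S) (@zd_adj_irrefl T S).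

(* inl i stands for a_(i+1) and inr j for x_(j+1); only k <= 3 is meant. *)
Definition M3_rel (k : nat) : rel ('I_3 + 'I_k) := fun u v =>
  match u, v with
  | inl i, inl j => i != j
  | inl i, inr j | inr j, inl i => i == j :> nat
  | inr _, inr _ => false
  end.

Lemma M3_rel_sym k (u v : 'I_3 + 'I_k) : M3_rel u v -> M3_rel v u.
Proof. by case: u v => [i|i] [j|j] //=; rewrite eq_sym. Qed.

Lemma M3_rel_irrefl k (u : 'I_3 + 'I_k) : ~ M3_rel u u.
Proof. by case: u => [i|i] //=; rewrite eqxx. Qed.

Definition M3 (k : nat) : sgraph ('I_3 + 'I_k) :=
  SGraph (@M3_rel_sym k) (@M3_rel_irrefl k).

Inductive elt : Type := z0 | a1 | a2 | a3 | x1 | x2.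

(* The values p = a1 * a1 and q = a2 * a2 are left as parameters. *)
Definition table (p q : elt) (x y : elt) : elt :=
  match x, y with
  | z0, _ | _, z0 => z0
  | a1, a1 => p
  | a2, a2 => q
  | a1, a2 | a2, a1 => z0
  | a1, a3 | a3, a1 => z0
  | a2, a3 | a3, a2 => z0
  | a1, x1 | x1, a1 => z0
  | a1, x2 | x2, a1 => a1
  | a2, x1 | x1, a2 => a2
  | a2, x2 | x2, a2 => z0
  | a3, a3 => a3
  | a3, x1 | x1, a3 => a3
  | a3, x2 | x2, a3 => a3
  | x1, x1 => x1
  | x1, x2 | x2, x1 => a3
  | x2, x2 => x2
  end.

Definition has_table (S : czsemigroup elt) (p q : elt) : Prop :=
  zero S = z0 /\ mul S =2 table p q.

(* Main.v *)
From mathcomp Require Import all_boot.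
From Stdlib Require Import ClassicalEpsilon.
Require Import Defs.

Set Implicit Arguments.
Unset Strict Implicit.
Unset Printing Implicit Defensive.

(** Realisation.  Subsets of a three-element set form a semigroup under
    intersection, and two of them multiply to zero exactly when they are
    disjoint.  The empty set, the three singletons [a_i] and any chosen
    complements [x_j] of singletons are closed under intersection: singletons
    are pairwise disjoint, [x_j] misses only [a_j], and two different
    complements meet in a singleton.  With [k] complements, this is a
    zero-divisor semigroup with graph [M3 k] ([boolean_semigroup_graph]).

    Classification.  A labelling of the graph by the semigroup transports any
    semigroup with graph [M3 2] to the type [elt], where the graph says which
    products of two distinct nonzero elements vanish ([zero_pattern]).  A
    product is then found from what it annihilates: the annihilator of a
    product contains those of its factors, and few elements kill a given pair
    of others.  So [a1 * x2] and [a1 * a1], which both kill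
    [a3] and [x1], lie in [{z0, a1}] ([ann_a3_x1]).  The one delicate point is
    that [x1] is idempotent ([sqr_x1]).  Since [x1] and [x2] are idempotent,
    [x1 * x2] is fixed by both; it also kills [a1] and [a2], and this leaves
    only [a3].  The products of [a3] follow.  Only the squares of [a1] and
    [a2] stay free, with two values each ([zero_pattern_table]); exchanging
    the indices 1 and 2 identifies two of the four tables ([table_swap_iso]).
    The other three differ in their number of nonzero elements of square zero:
    two, one and none. *)

(** * Semigroups up to isomorphism *)

Lemma mul_zeror (T : Type) (S : czsemigroup T) x : mul S x (zero S) = zero S.
Proof. by rewrite mul_comm mul_zero. Qed.

Lemma semigroup_iso_trans (T U V : Type) (S : czsemigroup T)
    (S' : czsemigroup U) (S'' : czsemigroup V) :
  semigroup_iso S S' -> semigroup_iso S' S'' -> semigroup_iso S S''.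
Proof.
case=> f bij_f fM [g bij_g gM]; exists (g \o f); first exact: bij_comp.
by move=> x y; rewrite /= fM gM.
Qed.

Lemma morph_zero (T U : Type) (S : czsemigroup T) (S' : czsemigroup U) f :
  bijective f -> {morph f : x y / mul S x y >-> mul S' x y} ->
  f (zero S) = zero S'.
Proof.
case=> g fK gK fM.
by rewrite -[RHS](mul_zeror S' (f (zero S))) -[in RHS](gK (zero S')) -fM mul_zero.
Qed.

Lemma transport_semigroup (T U : Type) (S : czsemigroup T) (g : U -> T) :
  bijective g ->
  exists2 S' : czsemigroup U, g (zero S') = zero S &
    {morph g : x y / mul S' x y >-> mul S x y}.
Proof.
case=> h gK hK; pose m x y := h (mul S (g x) (g y)).
have mA : associative m by move=> x y z; rewrite /m !hK mul_assoc.
have mC : commutative m by move=> x y; rewrite /m mul_comm.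
have m0 : left_zero (h (zero S)) m by move=> x; rewrite /m hK mul_zero.
by exists (CZSemigroup mA mC m0) => [|x y]; rewrite /= hK.
Qed.

(** * Zero-divisor graphs as labellings *)

(** The nonzero zero-divisors of a zero-divisor semigroup are all its nonzero
    elements, so naming the vertices of the graph amounts to naming the whole
    carrier, with [None] for zero.  Unlike an isomorphism with [zd_graph S],
    such a bijection involves no proof components. *)
Definition zd_labelling (T V : Type) (S : czsemigroup T) (G : sgraph V)
    (h : option V -> T) : Prop :=
  [/\ bijective h, h None = zero S
    & forall u v,
        adj G u v <-> u <> v /\ mul S (h (Some u)) (h (Some v)) = zero S].

Lemma zd_vertex_inj (T : Type) (S : czsemigroup T) (u v : zd_vertex S) :
  sval u = sval v -> u = v.
Proof.
case: u v => [x p] [y q] /= eq_xy; case: y / eq_xy q => q.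
by rewrite (proof_irrelevance _ p q).
Qed.

(** Going from an isomorphism to a labelling requires deciding whether an
    element of the arbitrary type [T] is zero, hence excluded middle. *)
Lemma zd_graph_isoP (T V : Type) (S : czsemigroup T) (G : sgraph V) :
  zd_semigroup S ->
  graph_iso (zd_graph S) G <-> exists h, zd_labelling S G h.
Proof.
move=> zdS; split=> [[f [g fK gK] fG]|[h [[h' hK h'K] h0 hG]]].
  pose h w := if w is Some v then sval (g v) else zero S.
  pose h' x := match excluded_middle_informative (x = zero S) with
    | left _ => None
    | right nx0 => Some (f (exist _ x (conj nx0 (zdS x))))
    end.
  exists h; split=> // [|u v].
    exists h' => [[v|]|x]; rewrite /h'; case: excluded_middle_informative => //=.
    - by case: (svalP (g v)).
    - move=> nx0; congr Some; rewrite -[RHS]gK; congr f.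
      exact: zd_vertex_inj.
    - by move=> nx0; rewrite fK.
  rewrite -{1}(gK u) -{1}(gK v); apply: iff_trans (iff_sym (fG _ _)) _.
  split=> -[neq uv0]; split=> // eq_uv; first by apply: neq; rewrite eq_uv.
  by apply: neq; rewrite -(gK u) -(gK v) (zd_vertex_inj eq_uv).
have h_inj := can_inj hK.
have label (u : zd_vertex S) : {v | h (Some v) = sval u}.
  case def_v: (h' (sval u)) => [v|]; first by exists v; rewrite -def_v h'K.
  by case: (svalP u) => nu0 _; case: nu0; rewrite -(h'K (sval u)) def_v h0.
have zd_h v : h (Some v) <> zero S /\ zero_divisor S (h (Some v)).
  by split=> //; rewrite -h0 => /h_inj.
exists (fun u => sval (label u)) => [|u v].
  exists (fun v => exist _ (h (Some v)) (zd_h v) : zd_vertex S) => [u|v].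
    by apply: zd_vertex_inj; rewrite /= (svalP (label u)).
  by apply: Some_inj; apply: h_inj; rewrite (svalP (label _)).
apply: iff_trans (iff_sym (hG _ _)); rewrite !(svalP (label _)).
split=> -[neq uv0]; split=> // eq_uv; apply: neq.
  by rewrite -(svalP (label u)) eq_uv (svalP (label v)).
by apply: Some_inj; apply: h_inj; rewrite !(svalP (label _)).
Qed.

(** * Realisation by subsets of a three-element set *)

Section BooleanModel.

Variables (k : nat) (k_le3 : k <= 3).

Definition supp (w : option ('I_3 + 'I_k)) : {set 'I_3} :=
  match w with
  | None => set0
  | Some (inl i) => [set i]
  | Some (inr j) => ~: [set widen_ord k_le3 j]
  end.

Lemma card_supp w :
  #|supp w| = match w with None => 0 | Some (inl _) => 1 | _ => 2 end.
Proof.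
by case: w => [[i|j]|]; rewrite /= ?cards0 ?cards1 // cardsCs setCK cards1 card_ord.
Qed.

Lemma supp_inj : injective supp.
Proof.
move=> w w' eq_ww'; have := congr1 (fun A : {set _} => #|A|) eq_ww'.
rewrite !card_supp; case: w w' eq_ww' => [[i|j]|] [[i'|j']|] //=.
  by move=> /set1_inj->.
by move=> /(can_inj (@setCK _)) /set1_inj /(congr1 val) /= /val_inj ->.
Qed.

(** A singleton meets any set in itself or in nothing; two distinct complements
    of singletons meet in the remaining singleton, by counting. *)
Lemma supp_closed w w' : exists w'', supp w'' = supp w :&: supp w'.
Proof.
have atom i (A : {set 'I_3}) : exists w'', supp w'' = [set i] :&: A.
  have [iA|niA] := boolP (i \in A).
    by exists (Some (inl i)); apply/esym/setIidPl; rewrite sub1set.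
  exists None; apply/esym/setP=> x; rewrite !inE.
  by case: eqP => // ->; apply: negbTE.
case: w w' => [[i|j]|] [[i'|j']|] //=; try exact: atom.
- by rewrite setIC; apply: atom.
- have [->|neq_jj'] := eqVneq j j'; first by exists (Some (inr j')); rewrite setIid.
  suff /cards1P[i ->] : #|~: [set widen_ord k_le3 j]
                          :&: ~: [set widen_ord k_le3 j']| == 1.
    by exists (Some (inl i)).
  by rewrite -setCU cardsCs setCK card_ord cards2 -(inj_eq val_inj) /= neq_jj'.
- by exists None; rewrite setI0.
- by exists None; rewrite set0I.
- by exists None; rewrite set0I.
- by exists None; rewrite set0I.
Qed.

Definition supp_mul w w' : option ('I_3 + 'I_k) :=
  odflt None [pick w'' | supp w'' == supp w :&: supp w'].

Lemma suppM w w' : supp (supp_mul w w') = supp w :&: supp w'.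
Proof.
rewrite /supp_mul; case: pickP => [w'' /eqP //|no_w].
by have [w'' /eqP] := supp_closed w w'; rewrite no_w.
Qed.

Lemma supp_mulA : associative supp_mul.
Proof. by move=> u v w; apply: supp_inj; rewrite !suppM setIA. Qed.

Lemma supp_mulC : commutative supp_mul.
Proof. by move=> u v; apply: supp_inj; rewrite !suppM setIC. Qed.

Lemma supp_mul0 : left_zero None supp_mul.
Proof. by move=> u; apply: supp_inj; rewrite suppM set0I. Qed.

Definition boolean_semigroup := CZSemigroup supp_mulA supp_mulC supp_mul0.

Lemma supp_mul_eq0 w w' : supp_mul w w' = None <-> [disjoint supp w & supp w'].
Proof.
rewrite -setI_eq0 -suppM; split=> [->|/eqP ww'0]; first by rewrite eqxx.
exact: supp_inj.
Qed.

Lemma boolean_semigroup_zd : zd_semigroup boolean_semigroup.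
Proof.
move=> w; have [i niw] : exists i, i \notin supp w.
  have /set0Pn[i] : ~: supp w != set0.
    by rewrite -card_gt0 cardsCs setCK card_ord card_supp; case: w => [[]|].
  by rewrite inE; exists i.
exists (Some (inl i)) => //; apply/supp_mul_eq0.
by rewrite disjoint_sym disjoints1.
Qed.

Lemma boolean_semigroup_graph :
  graph_iso (zd_graph boolean_semigroup) (M3 k).
Proof.
apply/(zd_graph_isoP _ boolean_semigroup_zd); exists id; split=> //.
  by exists id.
move=> u v; suff -> : adj (M3 k) u v =
    is_true ((u != v) && [disjoint supp (Some u) & supp (Some v)]).
  split=> [/andP[/eqP neq_uv ?]|[/eqP neq_uv]]; last first.
    by move/supp_mul_eq0; rewrite neq_uv.
  by split=> //; apply/supp_mul_eq0.
congr is_true; case: u v => [i|j] [i'|j'] /=.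
- by rewrite disjoints1 inE -[inl i == _]/(i == i') andbb.
- by rewrite disjoints1 !inE negbK.
- by rewrite disjoint_sym disjoints1 !inE negbK.
- apply/esym/negbTE/nandP; right.
  rewrite -setI_eq0 -card_gt0 -setCU cardsCs setCK card_ord cards2.
  by case: (_ != _).
Qed.

End BooleanModel.

(** * The three tables *)

Definition atom_square (b : bool) (a : elt) : elt := if b then a else z0.

Lemma table_assoc b c :
  associative (table (atom_square b a1) (atom_square c a2)).
Proof. by case: b c => [] [] [] [] []. Qed.

Lemma table_comm p q : commutative (table p q).
Proof. by case=> [] []. Qed.

Lemma table_zero p q : left_zero z0 (table p q).
Proof. by []. Qed.

Definition table_semigroup b c : czsemigroup elt :=
  CZSemigroup (@table_assoc b c) (@table_comm _ _) (@table_zero _ _).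

Lemma table_semigroup_zd b c : zd_semigroup (table_semigroup b c).
Proof. by case; [exists a1|exists a2|exists a1|exists a1|exists a1|exists a2]. Qed.

Definition elt_of (w : option ('I_3 + 'I_2)) : elt :=
  match w with
  | None => z0
  | Some (inl i) => match val i with 0 => a1 | 1 => a2 | _ => a3 end
  | Some (inr j) => match val j with 0 => x1 | _ => x2 end
  end.

Definition of_elt (x : elt) : option ('I_3 + 'I_2) :=
  match x with
  | z0 => None
  | a1 => Some (inl ord0)
  | a2 => Some (inl (@Ordinal 3 1 isT))
  | a3 => Some (inl ord_max)
  | x1 => Some (inr ord0)
  | x2 => Some (inr ord_max)
  end.

Lemma of_eltK : cancel of_elt elt_of.
Proof. by case. Qed.

Lemma elt_ofK : cancel elt_of of_elt.
Proof.
by case=> [[[[|[|[|//]]] ?]|[[|[|//]] ?]]|] //=;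
  congr (Some (_ _)); apply: val_inj.
Qed.

Lemma elt_of_bij : bijective elt_of.
Proof. by exists of_elt; [apply: elt_ofK|apply: of_eltK]. Qed.

Lemma M3_table p q u v :
  adj (M3 2) u v <->
    u <> v /\ table p q (elt_of (Some u)) (elt_of (Some v)) = z0.
Proof.
case: u v => [[[|[|[|//]]] ?]|[[|[|//]] ?]] [[[|[|[|//]]] ?]|[[|[|//]] ?]] //=;
  split=> // -[] //.
all: by case; congr (_ _); apply: val_inj.
Qed.

Lemma table_semigroup_graph b c :
  graph_iso (zd_graph (table_semigroup b c)) (M3 2).
Proof.
apply/(zd_graph_isoP _ (@table_semigroup_zd b c)); exists elt_of; split=> //.
  exact: elt_of_bij.
exact: M3_table.
Qed.

Definition swap (x : elt) : elt :=
  match x with a1 => a2 | a2 => a1 | x1 => x2 | x2 => x1 | _ => x end.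

Lemma swapK : involutive swap.
Proof. by case. Qed.

Lemma table_swap_iso :
  semigroup_iso (table_semigroup true false) (table_semigroup false true).
Proof. by exists swap; [exact: inv_bij swapK | case=> [] []]. Qed.

(** Being nonzero of square zero is the invariant that separates the three
    tables. *)
Lemma iso_square_zero (T U : Type) (S : czsemigroup T) (S' : czsemigroup U) :
  semigroup_iso S S' ->
  exists2 f : T -> U, injective f &
    forall x, x <> zero S -> mul S x x = zero S ->
      f x <> zero S' /\ mul S' (f x) (f x) = zero S'.
Proof.
case=> f bij_f fM; have f0 := morph_zero bij_f fM; have f_inj := bij_inj bij_f.
exists f => // x nx0 xx0; rewrite -fM xx0 f0; split=> //.
by rewrite -f0 => /f_inj.
Qed.

Lemma table_not_iso12 :
  ~ semigroup_iso (table_semigroup false false) (table_semigroup false true).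
Proof.
case/iso_square_zero=> f f_inj fsq.
have nilp x : x <> z0 /\ table z0 a2 x x = z0 -> x = a1 by case: x => [] [].
have f_a1 : f a1 = a1 by apply/nilp/fsq.
have f_a2 : f a2 = a1 by apply/nilp/fsq.
by have := f_inj a1 a2; rewrite f_a1 f_a2 => /(_ erefl).
Qed.

Lemma table_not_iso3 c :
  ~ semigroup_iso (table_semigroup false c) (table_semigroup true true).
Proof.
case/iso_square_zero=> f _ /(_ a1) [] //=.
by case: (f a1).
Qed.

(** * Uniqueness *)

(** What the graph [M3 2] says about a multiplication on [elt]: nothing about
    squares, and of the other products only whether they vanish.  The tables
    all agree on this, so [table z0 z0] serves as the reference. *)
Definition zero_pattern (S : czsemigroup elt) : Prop :=
  zero S = z0 /\ forall u v, u <> v -> u <> z0 -> v <> z0 ->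
    (mul S u v = z0 <-> table z0 z0 u v = z0).

(** The pattern is symmetric in the indices 1 and 2, so that each product found
    for one index can be read for the other by renaming. *)
Lemma zero_pattern_swap S :
  zero_pattern S -> exists2 S', zero_pattern S' &
    {morph swap : x y / mul S' x y >-> mul S x y}.
Proof.
case=> S0 pat; have [S' S'0 swapM] := transport_semigroup S (inv_bij swapK).
exists S' => //; split=> [|u v neq_uv nu0 nv0].
  by rewrite -[LHS]swapK S'0 S0.
have -> : mul S' u v = z0 <-> mul S (swap u) (swap v) = z0.
  by rewrite -swapM; split=> [->|/(congr1 swap)] //; rewrite swapK.
apply: iff_trans (pat _ _ _ _ _) _.
- by move/(can_inj swapK).
- by case: (u) nu0.
- by case: (v) nv0.
by case: (u) (v) nu0 nv0 neq_uv => [] [].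
Qed.

Section Forced.

Variables (S : czsemigroup elt) (patS : zero_pattern S).

Local Notation "x * y" := (mul S x y).

Let pat u v : u <> v -> u <> z0 -> v <> z0 -> (u * v = z0 <-> table z0 z0 u v = z0).
Proof. by case: patS => _; apply. Qed.

Lemma mulz0 x : x * z0 = z0.
Proof. by case: patS => <- _; apply: mul_zeror. Qed.

Lemma mul0z x : z0 * x = z0.
Proof. by rewrite mul_comm mulz0. Qed.

(** Any element other than [z0] and [a1] has a nonzero product with a distinct
    element among [a3] and [x1], so the unknown squares do not matter. *)
Lemma ann_a3_x1 z : z * a3 = z0 -> z * x1 = z0 -> z = z0 \/ z = a1.
Proof.
by case: z => z3 z1; auto; [move/pat: z1|move/pat: z1|move/pat: z3|move/pat: z3] => -[].
Qed.

Lemma ann_a1_a2 z :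
  z <> z0 -> z * a1 = z0 -> z * a2 = z0 -> [\/ z = a1, z = a2 | z = a3].
Proof.
case: z => nz z1 z2 //; try by constructor.
  by move/pat: z2 => -[].
by move/pat: z1 => -[].
Qed.

Lemma mul_a1_x2 : a1 * x2 = a1.
Proof.
have a13 : a1 * a3 = z0 by apply/pat.
have a1x1 : a1 * x1 = z0 by apply/pat.
case: (@ann_a3_x1 (a1 * x2)) => //.
- by rewrite -mul_assoc (mul_comm S x2) mul_assoc a13 mul0z.
- by rewrite -mul_assoc (mul_comm S x2) mul_assoc a1x1 mul0z.
by move/pat=> -[].
Qed.

Lemma sqr_a1 : a1 * a1 = z0 \/ a1 * a1 = a1.
Proof.
have a13 : a1 * a3 = z0 by apply/pat.
have a1x1 : a1 * x1 = z0 by apply/pat.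
by apply: ann_a3_x1; rewrite -mul_assoc ?a13 ?a1x1 mulz0.
Qed.

(** The square of [x1] kills [a1] and fixes [a2], so it is [x1] or [a2].  The
    products [x1 * x2] and [a3 * x1] are nonzero and kill [a1] and [a2], so they
    lie in [{a1, a2, a3}].  If [x1 * x1 = a2], then
    [x1 * (x1 * x2) = a2 * x2 = z0] forces [x1 * x2 = a1], whence
    [(a3 * x1) * x2 = a3 * a1 = z0] forces [a3 * x1 = a2]; but then
    [a2 * x1 = a3 * (x1 * x1) = a3 * a2 = z0], and [a2], [x1] are not
    adjacent. *)
Lemma sqr_x1 : a2 * x1 = a2 -> x1 * x1 = x1.
Proof.
move=> a2x1.
have a12 : a1 * a2 = z0 by apply/pat.
have a13 : a1 * a3 = z0 by apply/pat.
have a23 : a2 * a3 = z0 by apply/pat.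
have a1x1 : a1 * x1 = z0 by apply/pat.
have a2x2 : a2 * x2 = z0 by apply/pat.
have sqr_a1x : a1 * (x1 * x1) = z0 by rewrite mul_assoc a1x1 mul0z.
have sqr_a2x : a2 * (x1 * x1) = a2 by rewrite mul_assoc !a2x1.
have : x1 * x1 = a2 \/ x1 * x1 = x1.
  move: sqr_a1x sqr_a2x; case: (x1 * x1) => e1 e2; auto.
  - by move: e2; rewrite mulz0.
  - by move: e2; rewrite mul_comm a12.
  - by move: e2; rewrite a23.
  - by move/pat: e1 => -[].
case=> // x1x1; exfalso.
have x12 : x1 * x2 = a1.
  have kill : x1 * (x1 * x2) = z0 by rewrite mul_assoc x1x1.
  case: (@ann_a1_a2 (x1 * x2)) => // [|||E|E].
  - by move/pat=> -[].
  - by rewrite mul_comm mul_assoc a1x1 mul0z.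
  - by rewrite -mul_assoc (mul_comm S x2) a2x2 mulz0.
  - by move: kill; rewrite E mul_comm a2x1.
  - by move: kill; rewrite E => /pat-[].
have kill2 : a3 * x1 * x2 = z0 by rewrite -mul_assoc x12 mul_comm.
have a3x1 : a3 * x1 = a2.
  case: (@ann_a1_a2 (a3 * x1)) => // [|||E|E].
  - by move/pat=> -[].
  - by rewrite mul_comm mul_assoc a13 mul0z.
  - by rewrite mul_comm mul_assoc a23 mul0z.
  - by move: kill2; rewrite E => /pat-[].
  - by move: kill2; rewrite E => /pat-[].
have : a3 * x1 * x1 = z0 by rewrite -mul_assoc x1x1 mul_comm.
by rewrite a3x1 a2x1.
Qed.

End Forced.

Lemma zero_pattern_table S :
  zero_pattern S -> exists b c, mul S =2 mul (table_semigroup b c).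
Proof.
move=> patS; have [S' patS' swapM] := zero_pattern_swap patS.
have [S0 pat] := patS; have mC := mul_comm S.
have a1x2 := mul_a1_x2 patS.
have a2x1 : mul S a2 x1 = a2 by rewrite -[RHS]/(swap a1) -(mul_a1_x2 patS') swapM.
have a2x1' : mul S' a2 x1 = a2.
  by rewrite -[LHS]swapK swapM a1x2.
have x1x1 := sqr_x1 patS a2x1.
have x2x2 : mul S x2 x2 = x2.
  by rewrite -[RHS]/(swap x1) -(sqr_x1 patS' a2x1') swapM.
have a1x1 : mul S a1 x1 = z0 by apply/pat.
have a2x2 : mul S a2 x2 = z0 by apply/pat.
have x1x2 : mul S x1 x2 = a3.
  have fix1 : mul S x1 (mul S x1 x2) = mul S x1 x2 by rewrite mul_assoc x1x1.
  have fix2 : mul S (mul S x1 x2) x2 = mul S x1 x2 by rewrite -mul_assoc x2x2.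
  case: (@ann_a1_a2 _ patS (mul S x1 x2)) => // [||| E | E].
  - by move/pat=> -[].
  - by rewrite mC mul_assoc a1x1 (mul0z patS).
  - by rewrite -mul_assoc (mC x2) a2x2 (mulz0 patS).
  - by move: fix1; rewrite E mC a1x1.
  - by move: fix2; rewrite E a2x2.
have a3x1 : mul S a3 x1 = a3 by rewrite mC -x1x2 mul_assoc x1x1.
have a3x2 : mul S a3 x2 = a3 by rewrite -x1x2 -mul_assoc x2x2.
have a3a3 : mul S a3 a3 = a3 by rewrite -{2}x1x2 mul_assoc a3x1.
have a1a2 : mul S a1 a2 = z0 by apply/pat.
have a1a3 : mul S a1 a3 = z0 by apply/pat.
have a2a3 : mul S a2 a3 = z0 by apply/pat.
have [b a1a1] : exists b, mul S a1 a1 = atom_square b a1.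
  by case: (sqr_a1 patS); [exists false|exists true].
have [c a2a2] : exists c, mul S a2 a2 = atom_square c a2.
  rewrite -[X in mul S X _]/(swap a1) -[X in mul S _ X]/(swap a1) -swapM.
  by case: (sqr_a1 patS') => ->; [exists false|exists true].
exists b, c => u v.
by case: u v => [] []; rewrite /= ?(mulz0 patS) ?(mul0z patS) //; rewrite mC.
Qed.

Lemma labelling_zero_pattern S :
  zd_labelling S (M3 2) elt_of -> zero_pattern S.
Proof.
case=> _ /esym S0 adjS; split=> // u v neq_uv nu0 nv0.
have [u' def_u] : exists u', elt_of (Some u') = u.
  by case def: (of_elt u) => [u'|]; [exists u'|case: nu0];
      rewrite -(of_eltK u) def.
have [v' def_v] : exists v', elt_of (Some v') = v.
  by case def: (of_elt v) => [v'|]; [exists v'|case: nv0];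
      rewrite -(of_eltK v) def.
have neq_uv' : u' <> v' by move=> eq_uv; case: neq_uv; rewrite -def_u eq_uv.
move: (adjS u' v') (M3_table z0 z0 u' v'); rewrite def_u def_v S0 /=.
tauto.
Qed.

Lemma zd_M32_table (T : Type) (S : czsemigroup T) :
  zd_semigroup S -> graph_iso (zd_graph S) (M3 2) ->
  exists b c, semigroup_iso S (table_semigroup b c).
Proof.
move=> zdS /(zd_graph_isoP _ zdS)[h [[h' hK h'K] h0 adjS]].
pose g := h \o of_elt; pose g' := elt_of \o h'.
have gK : cancel g g' by move=> x; rewrite /g' /g /= hK of_eltK.
have g'K : cancel g' g by move=> x; rewrite /g' /g /= elt_ofK h'K.
have [|S' gS0 gM] := transport_semigroup S (g := g); first by exists g'.
have [b [c eqS]] : exists b c, mul S' =2 mul (table_semigroup b c).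
  apply/zero_pattern_table/labelling_zero_pattern; split.
  - exact: elt_of_bij.
  - by apply: (can_inj gK); rewrite gS0 -h0.
  - move=> u v; apply: iff_trans (adjS u v) _.
    rewrite -(elt_ofK (Some u)) -(elt_ofK (Some v)) -[h _]/(g _).
    rewrite -[h (of_elt (elt_of (Some v)))]/(g _) -gM -gS0 !elt_ofK.
    by split=> -[neq E]; split=> //; [apply: (can_inj gK)|rewrite E].
exists b, c, g'; first by exists g.
by move=> x y; rewrite -eqS; apply: (can_inj gK); rewrite gM !g'K.
Qed.

Theorem theorem2p3 :
  (forall k : nat, k <= 3 ->
     exists (T : Type) (S : czsemigroup T),
       zd_semigroup S /\ graph_iso (zd_graph S) (M3 k)) /\
  (exists S1 S2 S3 : czsemigroup elt,
     [/\ has_table S1 z0 z0, has_table S2 z0 a2 & has_table S3 a1 a2] /\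
     [/\ zd_semigroup S1 /\ graph_iso (zd_graph S1) (M3 2),
         zd_semigroup S2 /\ graph_iso (zd_graph S2) (M3 2)
       & zd_semigroup S3 /\ graph_iso (zd_graph S3) (M3 2)] /\
     [/\ ~ semigroup_iso S1 S2, ~ semigroup_iso S1 S3 & ~ semigroup_iso S2 S3] /\
     (forall (T : Type) (S : czsemigroup T),
        zd_semigroup S -> graph_iso (zd_graph S) (M3 2) ->
        [\/ semigroup_iso S S1, semigroup_iso S S2 | semigroup_iso S S3])).
Proof.
split=> [k k_le3|].
  exists _, (boolean_semigroup k_le3).
  by split; [apply: boolean_semigroup_zd|apply: boolean_semigroup_graph].
exists (table_semigroup false false), (table_semigroup false true),
  (table_semigroup true true).
split; first by [].
split; first by split; split;
  [apply: table_semigroup_zd|apply: table_semigroup_graph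
  |apply: table_semigroup_zd|apply: table_semigroup_graph
  |apply: table_semigroup_zd|apply: table_semigroup_graph].
split; first by split; [apply: table_not_iso12|apply: table_not_iso3
  |apply: table_not_iso3].
move=> T S zdS isoG; have [[] [[] isoS]] := zd_M32_table zdS isoG.
- exact: Or33.
- by apply: Or32; apply: semigroup_iso_trans isoS table_swap_iso.
- exact: Or32.
- exact: Or31.
Qed.
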